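(* Let $G\rightrightarrows Q$ be a Lie groupoid and $L_d:G_2\to\mathbb{R}$ a discrete second-order Lagrangian. Let $\Sigma_{L_d}\subset T^*(\mathcal{P}^{\alpha}G)$ be the Lagrangian submanifold of the cotangent groupoid $T^*(\mathcal{P}^{\alpha}G)$ generated by $L_d$. A sequence $\gamma_{(g_1,g_2)},\ldots,\gamma_{(g_{N-1},g_N)}$, where $(g_k,g_{k+1})\in G_2$ and $$\gamma_{(g_k,g_{k+1})}=(\mu_{g_k},\tilde\mu_{g_k},\bar\mu_{g_{k+1}})\in T^*_{(g_k,g_k,g_{k+1})}(\mathcal{P}^{\alpha}G),\qquad k=1,\ldots,N-1,$$ satisfies the discrete second-order dynamics on $\Sigma_{L_d}$ if and only if $$\langle\overleftarrow{X}(g_k),\tilde\mu_{g_k}\rangle+\langle Y(g_{k+1}),\bar\mu_{g_{k+1}}\rangle=\langle\overrightarrow{X}(g_{k+1}),\tilde\mu_{g_{k+1}}\rangle-\langle Y(g_{k+1}),\mu_{g_{k+1}}\rangle,\qquad k=1,\ldots,N-2,$$ for every section $Z=(X,Y)\in\Gamma(A(\mathcal{P}^{\alpha}G))$, and $$\mu_{g_k}+\tilde\mu_{g_k}=D_1L_d(g_k,g_{k+1}),\qquad \bar\mu_{g_{k+1}}=D_2L_d(g_k,g_{k+1}),\qquad k=1,\ldots,N-1.$$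
   Context: A Lie groupoid $G\rightrightarrows Q$ has source $\alpha$, target $\beta$, identity section $\epsilon$, inversion $i$, and multiplication $gh$ defined on $G_2=\{(g,h)\in G\times G\mid\beta(g)=\alpha(h)\}$. Left and right translations are $\ell_g(h)=gh$, $r_g(h)=hg$. The Lie algebroid $AG\to Q$ has fibre $A_qG=\ker T_{\epsilon(q)}\alpha$; a section $X$ determines the left-invariant vector field $\overleftarrow{X}(g)=T_{\epsilon(\beta(g))}\ell_g(X(\beta(g)))$ and the right-invariant vector field $\overrightarrow{X}(g)=-T_{\epsilon(\alpha(g))}(r_g\circ i)(X(\alpha(g)))$. The same definitions apply to any Lie groupoid. A discrete second-order Lagrangian is a smooth function $L_d:G_2\to\mathbb{R}$. The prolongation of $G$ over $\alpha$ is the Lie groupoid $$\mathcal{P}^{\alpha}G=\{(g,h,r)\in G\times G\times G\mid \alpha(g)=\alpha(h),\ \beta(h)=\alpha(r)\}\rightrightarrows G,$$ with source $\alpha^{\alpha}(g,h,r)=g$, target $\beta^{\alpha}(g,h,r)=r$, multiplication $(g,h,r)(r,h',s)=(g,hh',s)$, identity $g\mapsto(g,\epsilon(\alpha(g)),g)$ and inversion $(g,h,r)\mapsto(r,h^{-1},g)$. Its Lie algebroid $A(\mathcal{P}^{\alpha}G)\to G$ has fibre at $g$ equal to $\{(a,Y_g)\in A_{\alpha(g)}G\times T_gG\mid T\alpha(Y_g)=T\beta(a)\}$, where $(a,Y_g)$ is identified with the tangent vector $(0_g,a,Y_g)$ at the identity over $g$. Sections are written $Z=(X,Y)$, meaning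 $Z(g)=(X(\alpha(g)),Y(g))$ with $X\in\Gamma(AG)$ and $Y$ a vector field on $G$ such that $T\alpha(Y(g))=T\beta(X(\alpha(g)))$ for all $g$. The associated invariant vector fields are $\overleftarrow{Z}(g,h,r)=(0,\overleftarrow{X}(h),Y(r))$ and $\overrightarrow{Z}(g,h,r)=(-Y(g),\overrightarrow{X}(h),0)$. The cotangent groupoid $T^*(\mathcal{P}^{\alpha}G)\rightrightarrows A^*(\mathcal{P}^{\alpha}G)$ is a symplectic groupoid with the canonical symplectic form; for $\mu\in T^*_{(g,h,r)}(\mathcal{P}^{\alpha}G)$ its source $\tilde\alpha(\mu)\in A_g^*(\mathcal{P}^{\alpha}G)$ and target $\tilde\beta(\mu)\in A_r^*(\mathcal{P}^{\alpha}G)$ are given by $\langle\tilde\alpha(\mu),Z(g)\rangle=\langle\mu,\overrightarrow{Z}(g,h,r)\rangle$ and $\langle\tilde\beta(\mu),Z(r)\rangle=\langle\mu,\overleftarrow{Z}(g,h,r)\rangle$ for all sections $Z$ of $A(\mathcal{P}^{\alpha}G)$. Let $i_{G_2}:G_2\hookrightarrow\mathcal{P}^{\alpha}G$, $i_{G_2}(g,h)=(g,g,h)$. The Lagrangian submanifold generated by $L_d$ is $\Sigma_{L_d}=\{\mu\in T^*(\mathcal{P}^{\alpha}G)\mid i_{G_2}^*\mu=dL_d\}$ (covectors based at points of $i_{G_2}(G_2)$). A sequence $\gamma_{(g_1,g_2)},\ldots,\gamma_{(g_{N-1},g_N)}\in T^*(\mathcal{P}^{\alpha}G)$ as in the claim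 satisfies the discrete second-order dynamics on $\Sigma_{L_d}$ if all its elements lie in $\Sigma_{L_d}$ and $\tilde\alpha(\gamma_{(g_k,g_{k+1})})=\tilde\beta(\gamma_{(g_{k-1},g_k)})$ for $k=2,\ldots,N-1$. The triple $(\mu_{g_k},\tilde\mu_{g_k},\bar\mu_{g_{k+1}})\in T^*_{g_k}G\times T^*_{g_k}G\times T^*_{g_{k+1}}G$ represents a covector on $\mathcal{P}^{\alpha}G\subset G\times G\times G$ by restriction to $T(\mathcal{P}^{\alpha}G)$. $D_1L_d,D_2L_d$ are the partial differentials with respect to the first and second argument (of any local smooth extension of $L_d$ to $G\times G$); the last two equalities of the claim together are understood as equality of $(\mu_{g_k}+\tilde\mu_{g_k},\bar\mu_{g_{k+1}})$ and $(D_1L_d,D_2L_d)$ as covectors on $T_{(g_k,g_{k+1})}G_2$, i.e. $\langle\mu_{g_k}+\tilde\mu_{g_k},u\rangle+\langle\bar\mu_{g_{k+1}},w\rangle=dL_d(g_k,g_{k+1})(u,w)$ for all $(u,w)\in T_{(g_k,g_{k+1})}G_2$. *)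

(* Defs.v *)
From HB Require Import structures.
From mathcomp Require Import all_boot all_order all_algebra.
From mathcomp Require Import all_classical all_reals all_analysis.
Set Implicit Arguments.
Unset Strict Implicit.
Unset Printing Implicit Defensive.
Import Order.TTheory GRing.Theory Num.Theory.
Import numFieldNormedType.Exports.
Local Open Scope classical_set_scope.
Local Open Scope ring_scope.

Section SmoothCalculus.
Context (R : realType) (V W : normedModType R).

(* Used with U open and V finite-dimensional, where f is C^(k+1) iff it is
   differentiable and each directional derivative x |-> 'd f x v is C^k. *)
Fixpoint Ck (k : nat) (U : set V) (f : V -> W) : Prop :=
  match k with
  | 0 => forall x, U x -> {for x, continuous f}
  | k'.+1 => (forall x, U x -> differentiable f x) /\
             (forall v : V, Ck k' U (fun x => 'd f x v))
  end.

Definition smooth_on (U : set V) (f : V -> W) := forall k, Ck k U f.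

Definition smooth_near (f : V -> W) (x : V) :=
  exists U : set V, [/\ open U, U x & smooth_on U f].

End SmoothCalculus.

(* A space with, for each point x, a preferred chart [coord x] around x and its
   inverse [param x]; both are total functions, meaningful only near x and near
   [coord x x] respectively.  The tangent space at x is [model], through the
   preferred chart at x.  No axioms are imposed here: manifolds are below. *)
Record charted (R : realType) := Charted {
  cpoint :> topologicalType;
  model : normedModType R;
  coord : cpoint -> cpoint -> model;
  param : cpoint -> model -> cpoint }.

Definition prod_charted (R : realType) (M N : charted R) : charted R :=
  @Charted R (M * N)%type (model M * model N)%type
    (fun p q => (coord p.1 q.1, coord p.2 q.2))
    (fun p u => (param p.1 u.1, param p.2 u.2)).

Definition real_charted (R : realType) : charted R :=
  @Charted R R^o R^o (fun _ y => y) (fun _ y => y).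

Section SmoothMaps.
Context (R : realType) (M N : charted R).

Definition local_rep (f : M -> N) (x : M) : model M -> model N :=
  coord (f x) \o f \o param x.

Definition smooth_at (f : M -> N) (x : M) :=
  {for x, continuous f} /\ smooth_near (local_rep f x) (coord x x).

Definition smooth_map (f : M -> N) := forall x, smooth_at f x.

Definition differential (f : M -> N) (x : M) : {linear model M -> model N} :=
  'd (local_rep f x) (coord x x).

(* F is a local smooth extension, around x, of the restriction of f to S. *)
Definition local_extension (S : set M) (f : M -> N) (x : M) (F : M -> N) :=
  smooth_at F x /\ (\forall y \near x, S y -> F y = f y).

(* Smoothness on a subset; for an embedded submanifold S, this is smoothness of
   f restricted to S.  The values of f outside S are irrelevant. *)
Definition smooth_within (S : set M) (f : M -> N) :=
  forall x, S x -> exists F, local_extension S f x F.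

(* Differential at x in S of the restriction of f to S, as the differential of a
   local smooth extension.  On vectors tangent to S (the only ones it is applied
   to below) it does not depend on the extension. *)
Definition differential_within (S : set M) (f : M -> N) (x : M) :
    {linear model M -> model N} :=
  match pselect (exists F, local_extension S f x F) with
  | left h => differential (projT1 (cid h)) x
  | right _ => differential f x
  end.

(* X is a vector field along f, X x being a tangent vector at f x expressed in
   the preferred chart at f x; smoothness is tested in the fixed chart
   [coord (f x0)] near each x0. *)
Definition smooth_along (f : M -> N) (X : M -> model N) :=
  forall x0 : M, smooth_near
    (fun u : model M => let y := f (param x0 u) in
       'd (coord (f x0) \o param y) (coord y y) (X (param x0 u)))
    (coord x0 x0).

End SmoothMaps.

(* Smooth manifolds of constant dimension, Hausdorff and second countable, given
   by an atlas (the charts [mcoord x] on [mdom x], for x a point). *)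
Record manifold (R : realType) := Manifold {
  mtop : topologicalType;
  mdim : nat;
  mdom : mtop -> set mtop;
  mcoord : mtop -> mtop -> 'rV[R]_mdim;
  mparam : mtop -> 'rV[R]_mdim -> mtop;
  mdom_open : forall x, open (mdom x);
  mdom_mem : forall x, mdom x x;
  mcoord_open : forall x, open (mcoord x @` mdom x);
  mcoordK : forall x y, mdom x y -> mparam x (mcoord x y) = y;
  mcoord_continuous : forall x y, mdom x y -> {for y, continuous (mcoord x)};
  mparam_continuous : forall x u, (mcoord x @` mdom x) u ->
    {for u, continuous (mparam x)};
  mchart_compatible : forall x y,
    smooth_on (mcoord x @` (mdom x `&` mdom y)) (mcoord y \o mparam x);
  mtop_hausdorff : hausdorff_space mtop;
  mtop_second_countable : @second_countable mtop }.

Definition charted_of (R : realType) (M : manifold R) : charted R :=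
  @Charted R (mtop M) 'rV[R]_(mdim M) (@mcoord R M) (@mparam R M).
Coercion charted_of : manifold >-> charted.

(* As a type, [tangent x] does not depend on x, so an equation between
   tangent x and tangent y typechecks even if x and y are different terms; it is
   only ever written when x = y holds. *)
Definition tangent (R : realType) (M : manifold R) (x : M) : vectType R :=
  'rV[R]_(mdim M).

Definition cotangent (R : realType) (M : manifold R) (x : M) : vectType R :=
  'Hom(tangent x, R^o).

Definition tmap (R : realType) (M N : manifold R) (f : M -> N) (x : M) :
  'Hom(tangent x, tangent (f x)) := linfun (differential f x).

Definition submersion (R : realType) (M N : manifold R) (f : M -> N) :=
  smooth_map f /\
  forall x (w : tangent (f x)), exists v : tangent x, tmap f x v = w.

(* The product g h is meaningful when tgt g = src h; [mul] is total, with
   irrelevant values elsewhere. *)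
Record lieGroupoid (R : realType) := LieGroupoid {
  arrow :> manifold R;
  base : manifold R;
  src : arrow -> base;
  tgt : arrow -> base;
  unit : base -> arrow;
  inv : arrow -> arrow;
  mul : arrow -> arrow -> arrow;
  src_unit : forall q, src (unit q) = q;
  tgt_unit : forall q, tgt (unit q) = q;
  src_inv : forall g, src (inv g) = tgt g;
  tgt_inv : forall g, tgt (inv g) = src g;
  src_mul : forall g h, tgt g = src h -> src (mul g h) = src g;
  tgt_mul : forall g h, tgt g = src h -> tgt (mul g h) = tgt h;
  mulA : forall g h k, tgt g = src h -> tgt h = src k ->
    mul g (mul h k) = mul (mul g h) k;
  mul_unitl : forall g, mul (unit (src g)) g = g;
  mul_unitr : forall g, mul g (unit (tgt g)) = g;
  mul_invl : forall g, mul (inv g) g = unit (tgt g);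
  mul_invr : forall g, mul g (inv g) = unit (src g);
  src_submersion : submersion src;
  tgt_submersion : submersion tgt;
  unit_smooth : smooth_map unit;
  inv_smooth : smooth_map inv;
  mul_smooth : @smooth_within R (prod_charted arrow arrow) arrow
    [set gh | tgt gh.1 = src gh.2] (fun gh => mul gh.1 gh.2) }.

Section Groupoid.
Context (R : realType) (G : lieGroupoid R).
Implicit Types (g h r : G) (q : base G).

Definition G2 : set (G * G) := [set gh | tgt gh.1 = src gh.2].

Definition TG2 (gh : G * G) : {vspace (tangent gh.1 * tangent gh.2)%type} :=
  lker (linfun (fun u : (tangent gh.1 * tangent gh.2)%type =>
    tmap (@tgt R G) gh.1 u.1 - tmap (@src R G) gh.2 u.2)).

Definition algebroid q : {vspace tangent (unit q)} :=
  lker (tmap (@src R G) (unit q)).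

Record algebroid_section := AlgebroidSection {
  asec : forall q, tangent (unit q);
  asec_mem : forall q, asec q \in algebroid q;
  asec_smooth : @smooth_along R (base G) G (@unit R G) asec }.

(* [left_invariant X g] is the tangent map at unit (tgt g) of the left
   translation k |-> g k, defined on the src-fibre over tgt g, applied to X. *)
Definition left_invariant (X : algebroid_section) g : tangent g :=
  @differential_within R G G [set k | src k = tgt g] (mul g)
    (unit (tgt g)) (asec X (tgt g)).

(* Likewise for k |-> k^-1 g, defined on the src-fibre over src g. *)
Definition right_invariant (X : algebroid_section) g : tangent g :=
  - @differential_within R G G [set k | src k = src g]
      (fun k => mul (inv k) g) (unit (src g)) (asec X (src g)).

(* Triples (g, h, r) are represented as ((g, h), r). *)
Definition prolongation : set (G * G * G) :=
  [set p | src p.1.1 = src p.1.2 /\ tgt p.1.2 = src p.2].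

Definition tangent3 (p : G * G * G) : vectType R :=
  (tangent p.1.1 * tangent p.1.2 * tangent p.2)%type.

Definition Tprolongation (p : G * G * G) : {vspace tangent3 p} :=
  (lker (linfun (fun u : tangent3 p =>
     tmap (@src R G) p.1.1 u.1.1 - tmap (@src R G) p.1.2 u.1.2)) :&:
   lker (linfun (fun u : tangent3 p =>
     tmap (@tgt R G) p.1.2 u.1.2 - tmap (@src R G) p.2 u.2)))%VS.

Definition Aprolongation g :
    {vspace (tangent (unit (src g)) * tangent g)%type} :=
  (lker (linfun (fun z : (tangent (unit (src g)) * tangent g)%type =>
     tmap (@src R G) (unit (src g)) z.1)) :&:
   lker (linfun (fun z : (tangent (unit (src g)) * tangent g)%type =>
     tmap (@src R G) g z.2 - tmap (@tgt R G) (unit (src g)) z.1)))%VS.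

Record prolongation_section := ProlongationSection {
  psecX : algebroid_section;
  psecY : forall g, tangent g;
  psecY_smooth : @smooth_along R G G id psecY;
  psec_anchor : forall g, tmap (@src R G) g (psecY g) =
    tmap (@tgt R G) (unit (src g)) (asec psecX (src g)) }.

(* In the next three definitions the projection [vsproj] onto a subspace is
   applied to an element of that subspace (for p in the prolongation). *)
Definition psec_val (Z : prolongation_section) g : subvs_of (Aprolongation g) :=
  vsproj (Aprolongation g) (asec (psecX Z) (src g), psecY Z g).

Definition prolongation_left (Z : prolongation_section) (p : G * G * G) :
    subvs_of (Tprolongation p) :=
  vsproj (Tprolongation p)
    ((0, left_invariant (psecX Z) p.1.2), psecY Z p.2).

Definition prolongation_right (Z : prolongation_section) (p : G * G * G) :
    subvs_of (Tprolongation p) :=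
  vsproj (Tprolongation p)
    ((- psecY Z p.1.1, right_invariant (psecX Z) p.1.2), 0).

(* The total spaces of the cotangent bundle of the prolongation (relevant over
   points of [prolongation]) and of the dual of its Lie algebroid. *)
Definition TSprolongation : Type :=
  {p : G * G * G & 'Hom(subvs_of (Tprolongation p), R^o)}.

Definition ASprolongation : Type :=
  {g : G & 'Hom(subvs_of (Aprolongation g), R^o)}.

(* The functional is unique since each vector of Aprolongation g is the value
   at g of a section; [xget] selects it. *)
Definition cotangent_src (mu : TSprolongation) : ASprolongation :=
  let: existT p m := mu in
  existT _ p.1.1 (xget 0 [set nu : 'Hom(subvs_of (Aprolongation p.1.1), R^o) |
    forall Z, nu (psec_val Z p.1.1) = m (prolongation_right Z p)]).

Definition cotangent_tgt (mu : TSprolongation) : ASprolongation :=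
  let: existT p m := mu in
  existT _ p.2 (xget 0 [set nu : 'Hom(subvs_of (Aprolongation p.2), R^o) |
    forall Z, nu (psec_val Z p.2) = m (prolongation_left Z p)]).

(* A discrete second-order Lagrangian is a smooth function on G2; the values of
   L outside G2 are irrelevant. *)
Definition lagrangian (L : G * G -> R) :=
  @smooth_within R (prod_charted G G) (real_charted R) G2 L.

Definition dL (L : G * G -> R) (gh : G * G) :
    'Hom(subvs_of (TG2 gh), R^o) :=
  linfun (fun u : subvs_of (TG2 gh) =>
    @differential_within R (prod_charted G G) (real_charted R) G2 L gh
      (vsval u)).

(* Partial differentials at gh of a local smooth extension of L to G * G. *)
Definition D1L (L : G * G -> R) (gh : G * G) : cotangent gh.1 :=
  linfun (fun u : tangent gh.1 =>
    @differential_within R (prod_charted G G) (real_charted R) G2 L gh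
      (u, 0)).

Definition D2L (L : G * G -> R) (gh : G * G) : cotangent gh.2 :=
  linfun (fun w : tangent gh.2 =>
    @differential_within R (prod_charted G G) (real_charted R) G2 L gh
      (0, w)).

Definition iG2 (gh : G * G) : G * G * G := ((gh.1, gh.1), gh.2).

(* Tangent map of iG2, mapping (u, w) to (u, u, w). *)
Definition TiG2 (gh : G * G) :
    'Hom(subvs_of (TG2 gh), subvs_of (Tprolongation (iG2 gh))) :=
  linfun (fun u : subvs_of (TG2 gh) =>
    vsproj (Tprolongation (iG2 gh))
      (((vsval u).1, (vsval u).1), (vsval u).2)).

Definition SigmaL (L : G * G -> R) : set TSprolongation :=
  [set mu | exists gh, exists m : 'Hom(subvs_of (Tprolongation (iG2 gh)), R^o),
     [/\ G2 gh, mu = existT _ (iG2 gh) m & (m \o TiG2 gh)%VF = dL L gh]].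

Definition restrict3 (g h r : G)
    (a : cotangent g) (b : cotangent h) (c : cotangent r) : TSprolongation :=
  existT _ ((g, h), r)
    (linfun (fun u : subvs_of (Tprolongation ((g, h), r)) =>
       a (vsval u).1.1 + b (vsval u).1.2 + c (vsval u).2)).

(* gamma k, for k = 1, ..., N - 1, stands for the covector indexed by
   (g_k, g_(k+1)). *)
Definition second_order_dynamics (L : G * G -> R) (N : nat)
    (gamma : nat -> TSprolongation) :=
  (forall k, (1 <= k <= N - 1)%N -> SigmaL L (gamma k)) /\
  (forall k, (2 <= k <= N - 1)%N ->
     cotangent_src (gamma k) = cotangent_tgt (gamma k.-1)).

End Groupoid.

(* Main.v *)
From HB Require Import structures.
Require Import Defs.
From mathcomp Require Import all_boot all_order all_algebra.
From mathcomp Require Import all_classical all_reals all_analysis.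
From mathcomp Require Import ring lra zify.
From Stdlib Require Import Eqdep_dec.
Import Order.TTheory GRing.Theory Num.Theory.
Import numFieldNormedType.Exports.
Set Implicit Arguments.
Unset Strict Implicit.
Unset Printing Implicit Defensive.
Local Open Scope classical_set_scope.
Local Open Scope ring_scope.

(* Pulling a covector back along (g, h) |-> (g, g, h) gives the conditions on
   dL, and pairing the source and target of consecutive covectors with sections
   gives the recursion.  What makes the pairings legitimate is that the invariant
   vectors are tangent to the prolongation: differentiating
   src (g k) = src g, tgt (g k) = tgt k, src (k^-1 g) = tgt k and
   tgt (k^-1 g) = tgt g along the src-fibre yields
   T src (left X) = 0, T tgt (left X) = T tgt X, T src (right X) = - T tgt X and
   T tgt (right X) = 0.  Since translations are only defined on src-fibres, this
   needs that a smooth map constant on a fibre of a submersion has a differential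
   vanishing on the kernel of that of the submersion. *)

(** * Differentials in normed spaces *)

Section Differentials.
Context (R : realType) (V W : normedModType R).
Implicit Types (f g : V -> W) (x : V).

(** Trades the little-o definition for explicit inequalities, in which the later estimates are
    carried out. Uniqueness of the differential lets one statement settle both differentiability and
    the value of the differential. *)
Lemma diff_approxP f (df : {linear V -> W}) x :
  differentiable f x /\ 'd f x = df :> (V -> W) <->
  continuous df /\ forall e, 0 < e ->
    \forall h \near 0, `|f (h + x) - f x - df h| <= e * `|h|.
Proof.
split=> [[dfx <-]|[dfc fE]].
  split; first exact: diff_continuous.
  move=> e e0; have /eqaddoP /(_ _ e0) := diff_locally dfx.
  by apply: filterS => h /=; rewrite /= !fctE /= opprD addrA.
have E : f \o shift x = cst (f x) + df +o_ 0 id.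
  apply/eqaddoP => e e0; have := fE _ e0.
  by apply: filterS => h /=; rewrite /= !fctE /= opprD addrA.
have dE := diff_unique dfc E.
by split=> //; apply/diff_locallyP; rewrite dE.
Qed.

Lemma near_eq_diff f g x : (\near x, f x = g x) -> differentiable f x ->
  differentiable g x /\ 'd g x = 'd f x :> (V -> W).
Proof.
move=> fg dfx; apply/diff_approxP.
have [fc fE] := (diff_approxP f ('d f x) x).1 (conj dfx erefl).
split=> // e e0; have fgx := nbhs_singleton fg.
rewrite (near_shift 0 x) subr0 in fg.
near=> h; rewrite -fgx -(near fg h) //=; near: h; exact: fE.
Unshelve. all: by end_near. Qed.

End Differentials.

(* Makes HB build the join [completeNormedModType] on matrices. *)
HB.instance Definition _ (R : realType) (m n : nat) := Complete.on 'M[R]_(m, n).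

(** * Mean value estimates on row vectors *)

Section RowVectors.
Context (R : realType).

Lemma rV_coord_le_norm n (w : 'rV[R]_n) i : `|w 0 i| <= `|w|.
Proof.
rewrite [leRHS]/Num.Def.normr/= mx_normrE.
exact: (@le_bigmax _ _ _ 0 (fun ij => `|w ij.1 ij.2|) (0, i)).
Qed.

Lemma rV_norm_le n (w : 'rV[R]_n) e : 0 <= e ->
  (forall i, `|w 0 i| <= e) -> `|w| <= e.
Proof.
move=> e0 we; rewrite [leLHS]/Num.Def.normr/= mx_normrE.
by apply: bigmax_le => // -[i j] _ /=; rewrite (ord1 i).
Qed.

Lemma linear_rowE n (V : lmodType R) (L : {linear 'rV[R]_n -> V}) w :
  L w = \sum_(i < n) w 0 i *: L (delta_mx 0 i).
Proof.
by rewrite [in LHS](row_sum_delta w) linear_sum; apply: eq_bigr => i _; rewrite linearZ.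
Qed.

(** The scalar mean value theorem is applied to each coordinate along the segment from [z] to [y].
    The intermediate point depends on the coordinate, but the norm on rows is the maximum norm, so
    the constant [e] survives unchanged. *)
Lemma mean_value_bound n m (f : 'rV[R]_n -> 'rV[R]_m) y z e : 0 <= e ->
  (forall t, t \in `[0, 1]%R -> differentiable f (z + t *: (y - z)) /\
     forall w, `|'d f (z + t *: (y - z)) w| <= e * `|w|) ->
  `|f y - f z| <= e * `|y - z|.
Proof.
move=> e0 fe; apply: rV_norm_le => [|j]; first by rewrite mulr_ge0.
pose p (t : R) := z + t *: (y - z).
pose c (t : R) : R := f (p t) 0 j.
have dp (t : R) : is_diff t p ( *:%R^~ (y - z)).
  by apply: is_diff_eq; rewrite add0r.
have dc (t : R) : t \in `[0, 1]%R -> is_derive t 1 c ('d f (p t) (y - z) 0 j).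
  move=> t01; have [df _] := fe t t01.
  have /derivable_mxP fp : derivable (f \o p) t 1.
    by apply/diff_derivable/differentiable_comp.
  apply: DeriveDef; first exact: fp.
  have := @derive_mx R R^o 1 m (f \o p) t 1 ((derivable_mxP _ _ _).2 fp).
  move/matrixP/(_ 0 j); rewrite mxE => <-.
  rewrite deriveE; last exact: differentiable_comp.
  by rewrite diff_comp //= diff_val scale1r.
have dc' (t : R) : t \in `]0, 1[%R -> is_derive t 1 c ('d f (p t) (y - z) 0 j).
  by move=> t01; apply: dc; exact: subset_itv_oo_cc t01.
have cc : {within `[(0 : R), 1], continuous c}.
  apply: derivable_within_continuous => t t01.
  by have [] := dc _ t01.
have [t t01] := MVT_segment ler01 dc' cc.
rewrite subr0 mulr1 => cE.
have -> : (f y - f z) 0 j = c 1 - c 0.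
  by rewrite /c /p scale1r scale0r addr0 subrKC !mxE.
rewrite cE; apply: le_trans (rV_coord_le_norm _ _) _.
by have [_] := fe t t01; apply.
Qed.

(** Expanding [w] in the standard basis leaves [n] terms to bound; the divisor [n.+1] stays nonzero
    when [n = 0]. *)
Lemma linear_dist_bound n (W : normedModType R) (L1 L2 : {linear 'rV[R]_n -> W}) e :
  0 <= e ->
  (forall i, `|L1 (delta_mx 0 i) - L2 (delta_mx 0 i)| <= e / n.+1%:R) ->
  forall w, `|L1 w - L2 w| <= e * `|w|.
Proof.
move=> e0 Le w; rewrite (linear_rowE L1) (linear_rowE L2) -sumrB.
apply: le_trans (ler_norm_sum _ _ _) _.
apply: (@le_trans _ _ (\sum_(i < n) e / n.+1%:R * `|w|)).
  apply: ler_sum => i _; rewrite -scalerBr normrZ mulrC.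
  by rewrite ler_pM // ?rV_coord_le_norm.
rewrite sumr_const card_ord -mulrnAl ler_wpM2r // -mulr_natr -mulrA.
by rewrite ler_piMr // mulrC ler_pdivrMr ?ltr0n // mul1r ler_nat.
Qed.

(** [Ck 1] only provides continuity of each directional derivative. Finitely many basis directions
    suffice to make it uniform in [w]. *)
Lemma diff_norm_continuous n m (U : set 'rV[R]_n) (f : 'rV[R]_n -> 'rV[R]_m) x e :
  Ck 1 U f -> U x -> 0 < e ->
  \forall y \near x, forall w, `|'d f y w - 'd f x w| <= e * `|w|.
Proof.
move=> [_ dfc] Ux e0.
have e'0 : 0 < e / n.+1%:R by rewrite divr_gt0 // ltr0n.
have : \forall y \near x, forall i : 'I_n,
    `|'d f x (delta_mx 0 i) - 'd f y (delta_mx 0 i)| <= e / n.+1%:R.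
  apply: (@filter_forall _ _ (fun i y => _ <= _) (nbhs x)) => i.
  by have /cvgrPdist_le/(_ _ e'0) := dfc (delta_mx 0 i) x Ux.
apply: filterS => y yE; apply: linear_dist_bound => [|i]; first exact: ltW.
by rewrite distrC.
Qed.

Lemma diff_sub_linear (V W : normedModType R) (f : V -> W) (A : {linear V -> W}) u :
  continuous A -> differentiable f u ->
  differentiable (fun v => f v - A v) u /\
  'd (fun v => f v - A v) u = (fun w => 'd f u w - A w) :> (V -> W).
Proof.
move=> Ac dfu.
have dA : is_diff u A A.
  by apply: DiffDef; [exact: linear_differentiable|rewrite diff_lin].
have dk : is_diff u (f - (A : V -> W)) (('d f u : V -> W) - (A : V -> W)).
  by apply: is_diffB; exact: differentiableP.
by split; [exact: (@ex_diff _ _ _ _ _ _ _ dk)|exact: (@diff_val _ _ _ _ _ _ _ dk)].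
Qed.

(** The mean value bound is applied to [f] minus its differential at [x], a map whose differential
    is small throughout a ball around [x]. *)
Lemma C1_strict_diff n m (U : set 'rV[R]_n) (f : 'rV[R]_n -> 'rV[R]_m) x e :
  open U -> Ck 1 U f -> U x -> 0 < e -> exists2 d, 0 < d &
    forall y z, `|y - x| < d -> `|z - x| < d ->
      `|f y - f z - 'd f x (y - z)| <= e * `|y - z|.
Proof.
move=> oU fC1 Ux e0.
have /nbhs_normP[d d0 dP] : \forall y \near x,
    U y /\ forall w, `|'d f y w - 'd f x w| <= e * `|w|.
  by near=> y; split; near: y; [exact: open_nbhs_nbhs|
    exact: diff_norm_continuous fC1 Ux e0].
have Ac : continuous ('d f x) by apply/diff_continuous/fC1.1.
exists d => // y z yx zx; move: Ac dP; move: ('d f x) => A Ac dP.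
pose k v := f v - A v.
have -> : f y - f z - A (y - z) = k y - k z.
  by rewrite /k linearB /= !opprD !opprK addrACA.
apply: mean_value_bound => [|t]; first exact: ltW.
rewrite in_itv /= => /andP[t0 t1].
have [|Uu du] := dP (z + t *: (y - z)); last first.
  have [dk kE] := diff_sub_linear Ac (fC1.1 _ Uu).
  by split=> // w; rewrite kE; exact: du.
rewrite /= distrC.
have -> : z + t *: (y - z) - x = t *: (y - x) + (1 - t) *: (z - x).
  by apply/rowP => i; rewrite !mxE; ring.
apply: le_lt_trans (ler_normD _ _) _; rewrite !normrZ !ger0_norm ?subr_ge0 //.
(* Strictness comes from the [y] term, hence needs [t > 0]; at [t = 0] the point is [z] itself. *)
have := t0; rewrite le_eqVlt => /predU1P[<-|t_gt0].
  by rewrite mul0r add0r subr0 mul1r.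
have : t * `|y - x| < t * d by rewrite ltr_pM2l.
have : (1 - t) * `|z - x| <= (1 - t) * d by rewrite ler_wpM2l ?subr_ge0 // ltW.
lra.
Unshelve. all: by end_near. Qed.

End RowVectors.

(** * Tangent vectors to level sets *)

Section LevelSets.
Context (R : realType).

(** The closed ball of radius [rho] is mapped into itself, half of [rho] coming from [phi 0] and
    half from the contraction, so Banach's theorem applies there. *)
Lemma half_contraction_fixpoint (X : completeNormedModType R) (phi : X -> X) rho :
  0 <= rho -> `|phi 0| <= rho / 2 ->
  (forall z z', `|z| <= rho -> `|z'| <= rho ->
    `|phi z - phi z'| <= 2^-1 * `|z - z'|) ->
  exists2 z, `|z| <= rho & phi z = z.
Proof.
move=> rho0 phi0 phiC.
pose U := [set z : X | `|z| <= rho].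
have phiU : {homo phi : z / U z >-> U z}.
  move=> z Uz; rewrite /U /= -(subrK (phi 0) (phi z)).
  apply: le_trans (ler_normD _ _) _.
  have := phiC z 0 Uz; rewrite normr0 subr0 => /(_ rho0).
  by move: Uz phi0; rewrite /U /=; lra.
have [|||z Uz zE] := @banach_fixed_point R X U (mkfun_fun phiU).
- exists (2^-1 : R)%:nng; split=> /=; first by rewrite invf_lt1 // ltr1n.
  by move=> [z z'] [/= Uz Uz']; exact: phiC.
- apply: (@closed_comp _ _ (fun z : X => `|z|) [set r | r <= rho]).
    by move=> z _; exact: norm_continuous.
  exact: closed_le.
- by exists 0; rewrite /U /= normr0.
by exists z.
Qed.

(* The correction w is sought in the image of a linear right inverse B of the
   differential A: solving h (x + t v + B z) = h x amounts to finding a fixed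
   point of z |-> z - (h (x + t v + B z) - h x), a contraction near 0. *)
Lemma level_set_tangent n m (U : set 'rV[R]_n) (h : 'rV[R]_n -> 'rV[R]_m) x v :
  open U -> Ck 1 U h -> U x -> (forall z, exists u, 'd h x u = z) ->
  'd h x v = 0 -> forall e, 0 < e -> exists2 d, 0 < d &
    forall t, 0 < t < d ->
      exists2 w, `|w| <= e * t & h (x + t *: v + w) = h x.
Proof.
move=> oU hC1 Ux hsurj dhv e e0.
have [b bE] : {b : 'I_m -> 'rV[R]_n & forall i, 'd h x (b i) = delta_mx 0 i}.
  by exists (fun i => projT1 (cid (hsurj (delta_mx 0 i)))) => i; case: cid.
pose B (z : 'rV[R]_m) := \sum_(i < m) z 0 i *: b i.
(* A Lipschitz constant for [B]; the summand 1 keeps it positive even when [m = 0]. *)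
pose K : R := 1 + \sum_(i < m) `|b i|.
have K0 : 0 < K by rewrite ltr_wpDr // sumr_ge0.
have BB z z' : B z - B z' = B (z - z').
  by rewrite /B -sumrB; apply: eq_bigr => i _; rewrite -scalerBl !mxE.
have B0 : B 0 = 0 by rewrite /B big1 // => i _; rewrite mxE scale0r.
have BK z : `|B z| <= K * `|z|.
  apply: le_trans (ler_norm_sum _ _ _) _.
  rewrite mulrDl mul1r mulr_suml ler_wpDl // ler_sum // => i _.
  by rewrite normrZ mulrC ler_wpM2l // rV_coord_le_norm.
have AB z : 'd h x (B z) = z.
  rewrite {2}(row_sum_delta z) /B linear_sum; apply: eq_bigr => i _.
  by rewrite linearZ bE.
(* The first bound makes the iteration a contraction of ratio 1/2, the second keeps the correction
   [B z] below [e * t]. *)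
pose c := Num.min (2 * K)^-1 (e / (2 * K * (`|v| + 1))).
have v1 : 0 < `|v| + 1 by rewrite ltr_wpDl.
have c0 : 0 < c.
  by rewrite lt_min invr_gt0 divr_gt0 ?mulr_gt0.
have cK : c * K <= 2^-1.
  rewrite -ler_pdivlMr // -invfM mulrC; rewrite /c ge_min.
  by rewrite (mulrC K) lexx.
have ce : K * (2 * c * (`|v| + 1)) <= e.
  have -> : K * (2 * c * (`|v| + 1)) = c * (2 * K * (`|v| + 1)) by ring.
  by rewrite -ler_pdivlMr ?mulr_gt0 // /c ge_min lexx orbT.
have [d d0 dP] := C1_strict_diff oU hC1 Ux c0.
move: ('d h x) dhv AB dP => A Av AB dP.
have ve0 : 0 < `|v| + e by rewrite ltr_wpDl.
(* For such [t] every point [x + t v + B z] used below stays in the ball of radius [d] where strict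
   differentiability holds. *)
exists (d / (`|v| + e)) => [|t /andP[t0]]; first by rewrite divr_gt0.
rewrite ltr_pdivlMr // => td.
(* Twice the bound [c * t * (|v| + 1)] on the first iterate, as the fixed point lemma requires. *)
pose rho := 2 * c * (`|v| + 1) * t.
have rho0 : 0 <= rho by rewrite !mulr_ge0 // ltW.
have Bz z : `|z| <= rho -> `|B z| <= e * t.
  move=> zr; apply: le_trans (BK z) _; apply: (@le_trans _ _ (K * rho)).
    by rewrite ler_wpM2l // ltW.
  by rewrite /rho mulrA ler_wpM2r // ltW.
have near_x z : `|z| <= rho -> `|x + t *: v + B z - x| < d.
  move=> zr; rewrite addrAC [x + _ - x]addrC addKr.
  apply: le_lt_trans (ler_normD _ _) _.
  rewrite normrZ (gtr0_norm t0); apply: le_lt_trans td.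
  by rewrite mulrDr lerD2l mulrC; exact: Bz.
have x_near : `|x - x| < d by rewrite subrr normr0.
pose phi z := z - (h (x + t *: v + B z) - h x).
have [||z zr] := @half_contraction_fixpoint _ phi rho rho0.
- rewrite /phi sub0r normrN B0 addr0.
  have := dP _ _ (near_x 0 _) x_near; rewrite normr0 B0 addr0 => /(_ rho0).
  have -> : x + t *: v - x = t *: v by rewrite addrAC subrr add0r.
  rewrite linearZ /= Av scaler0 subr0 normrZ (gtr0_norm t0) => /le_trans; apply.
  rewrite /rho (_ : _ / 2 = c * (t * (`|v| + 1))); last by field.
  by rewrite ler_pM2l // ler_pM2l // lerDl.
- move=> z z' zr z'r.
  have := dP _ _ (near_x z zr) (near_x z' z'r).
  have -> : x + t *: v + B z - (x + t *: v + B z') = B (z - z').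
    by rewrite -BB opprD addrACA subrr add0r.
  rewrite AB => hB.
  have -> : phi z - phi z' =
      - (h (x + t *: v + B z) - h (x + t *: v + B z') - (z - z')).
    by rewrite /phi; apply/rowP => i; rewrite !mxE; ring.
  rewrite normrN; apply: le_trans hB _.
  apply: (@le_trans _ _ (c * (K * `|z - z'|))).
    by rewrite ler_pM2l.
  by rewrite mulrA ler_wpM2r.
move=> /eqP; rewrite /phi -subr_eq0 addrAC subrr add0r oppr_eq0 subr_eq0.
by move=> /eqP hE; exists (B z) => //; exact: Bz.
Qed.

End LevelSets.

(** * Closure properties of smooth maps *)

Section CkClosure.
Context (R : realType).
Implicit Types V W : normedModType R.

Lemma Ck_ext V W k (U : set V) (f g : V -> W) : open U ->
  (forall x, U x -> f x = g x) -> Ck k U f -> Ck k U g.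
Proof.
move=> oU; elim: k f g => [|k IH] f g fg /=.
  move=> fc x Ux; have fx : f @ x --> f x by exact: fc.
  suff : g @ x --> g x by [].
  rewrite -(fg x Ux); apply: cvg_trans fx; apply: near_eq_cvg.
  have := open_nbhs_nbhs (conj oU Ux); apply: filterS => y Uy.
  by rewrite (fg y Uy).
have near_fg x : U x -> \near x, f x = g x.
  by move=> Ux; apply: filterS fg _; exact: open_nbhs_nbhs.
move=> [df dfk]; split=> [x Ux|v].
  by have [] := near_eq_diff (near_fg x Ux) (df x Ux).
apply: IH (dfk v) => x Ux.
by have [_ ->] := near_eq_diff (near_fg x Ux) (df x Ux).
Qed.

Lemma Ck_sub V W k (U U' : set V) (f : V -> W) :
  U' `<=` U -> Ck k U f -> Ck k U' f.
Proof.
move=> UU; elim: k f => [|k IH] f /=; first by move=> fc x /UU; exact: fc.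
by move=> [df dfk]; split=> [x /UU|v]; [exact: df|exact: IH].
Qed.

Lemma CkS V W k (U : set V) (f : V -> W) : Ck k.+1 U f -> Ck k U f.
Proof.
elim: k f => [|k IH] f [df dfk].
  by move=> x Ux; apply: differentiable_continuous; exact: df.
by split=> // v; apply: IH; exact: dfk.
Qed.

Lemma Ck_cst V W k (U : set V) (a : W) : Ck k U (fun=> a).
Proof.
elim: k a => [|k IH] a; first by move=> x _; exact: cst_continuous.
split=> [x _|v]; first exact: differentiable_cst.
rewrite (_ : (fun x => _) = fun=> 0); first exact: IH.
by apply/funext => x; rewrite (diff_cst a x).
Qed.

Lemma Ck_linear V W W' k (U : set V) (f : V -> W) (L : {linear W -> W'}) :
  open U -> continuous L -> Ck k U f -> Ck k U (L \o f).
Proof.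
move=> oU Lc; elim: k f => [|k IH] f.
  by move=> fc x Ux; apply: continuous_comp; [exact: fc|exact: Lc].
have dL y : differentiable L y by exact: linear_differentiable.
move=> [df dfk]; split=> [x Ux|v]; first exact: differentiable_comp (df x Ux) _.
apply: Ck_ext (IH _ (dfk v)) => // x Ux /=.
by rewrite (diff_comp (df x Ux) (dL _)) /= diff_lin.
Qed.

Lemma CkD V W k (U : set V) (f g : V -> W) : open U ->
  Ck k U f -> Ck k U g -> Ck k U (f + g).
Proof.
move=> oU; elim: k f g => [|k IH] f g.
  by move=> fc gc x Ux; apply: continuousD; [exact: fc|exact: gc].
move=> [df dfk] [dg dgk]; split=> [x Ux|v].
  exact: differentiableD (df x Ux) (dg x Ux).
apply: Ck_ext (IH _ _ (dfk v) (dgk v)) => // x Ux /=.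
by rewrite (diffD (df x Ux) (dg x Ux)).
Qed.

Lemma Ck_sum V W k (U : set V) (I : Type) (r : seq I) (f : I -> V -> W) : open U ->
  (forall i, Ck k U (f i)) -> Ck k U (fun x => \sum_(i <- r) f i x).
Proof.
move=> oU fk; elim: r => [|i r IH].
  by rewrite (_ : (fun x => _) = fun=> 0); [exact: Ck_cst|
    apply/funext => x; rewrite big_nil].
rewrite (_ : (fun x => _) = f i + (fun x => \sum_(i <- r) f i x)); last first.
  by apply/funext => x; rewrite big_cons.
exact: CkD.
Qed.

Lemma CkM V k (U : set V) (f g : V -> R^o) : open U ->
  Ck k U f -> Ck k U g -> Ck k U (fun x => (f x : R) * g x : R^o).
Proof.
move=> oU; elim: k f g => [|k IH] f g.
  by move=> fc gc x Ux; apply: continuousM; [exact: fc|exact: gc].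
move=> fk gk; have [df dfk] := fk; have [dg dgk] := gk.
split=> [x Ux|v]; first exact: differentiableM (df x Ux) (dg x Ux).
have := CkD oU (IH _ _ (CkS fk) (dgk v)) (IH _ _ (CkS gk) (dfk v)).
apply: Ck_ext => // x Ux /=.
by rewrite (diffM (df x Ux) (dg x Ux)).
Qed.

Lemma Ck_coordP V n k (U : set V) (f : V -> 'rV[R]_n) : open U ->
  Ck k U f <-> forall i, Ck k U (fun x => f x 0 i : R^o).
Proof.
move=> oU; split=> [fk i|fk].
  pose c (w : 'rV[R]_n) : R^o := w 0 i.
  have cl : linear c by move=> a u w; rewrite /c !mxE.
  pose cM := GRing.isLinear.Build _ _ _ _ _ cl.
  pose L : {linear _ -> _} := HB.pack c cM.
  by apply: (@Ck_linear _ _ _ _ _ _ L) => //; exact: coord_continuous.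
have -> : f = fun x => \sum_(i < n) f x 0 i *: delta_mx 0 i.
  by apply/funext => x; exact: row_sum_delta.
apply: Ck_sum => // i.
pose c (r : R^o) : 'rV[R]_n := r *: delta_mx 0 i.
have cl : linear c by move=> a u w; rewrite /c scalerDl scalerA.
pose cM := GRing.isLinear.Build _ _ _ _ _ cl.
pose L : {linear _ -> _} := HB.pack c cM.
by apply: (@Ck_linear _ _ _ _ _ _ L) => //; exact: scalel_continuous.
Qed.

(** By the chain rule a directional derivative of [g \o f] is a sum of products of coordinates of
    derivatives of [f] with partial derivatives of [g] composed with [f]. These partial derivatives
    are again scalar, so the induction hypothesis covers them. *)
Lemma Ck_comp_scalar V n k (U : set V) (U' : set 'rV[R]_n)
    (f : V -> 'rV[R]_n) (g : 'rV[R]_n -> R^o) :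
  open U -> (forall x, U x -> U' (f x)) ->
  Ck k U f -> Ck k U' g -> Ck k U (g \o f).
Proof.
move=> oU fU; elim: k f g fU => [|k IH] f g fU.
  by move=> fc gc x Ux; apply: continuous_comp; [exact: fc|exact/gc/fU].
move=> fk gk; have [df dfk] := fk; have [dg dgk] := gk.
split=> [x Ux|v].
  exact: differentiable_comp (df x Ux) (dg _ (fU _ Ux)).
have : Ck k U (fun x => \sum_(i < n)
    (('d f x v 0 i : R) * 'd g (f x) (delta_mx 0 i) : R^o)).
  apply: Ck_sum => // i; apply: CkM => //.
    exact: (Ck_coordP _ _ oU).1 (dfk v) i.
  by apply: IH (dgk _) => //; exact: CkS.
apply: Ck_ext => // x Ux.
by rewrite (diff_comp (df x Ux) (dg _ (fU _ Ux))) /= (linear_rowE ('d g (f x))).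
Qed.

Lemma Ck_comp V n m k (U : set V) (U' : set 'rV[R]_n)
    (f : V -> 'rV[R]_n) (g : 'rV[R]_n -> 'rV[R]_m) :
  open U -> open U' -> (forall x, U x -> U' (f x)) ->
  Ck k U f -> Ck k U' g -> Ck k U (g \o f).
Proof.
move=> oU oU' fU fk /(Ck_coordP _ _ oU') gk; apply/(Ck_coordP _ _ oU) => i.
exact: Ck_comp_scalar fU fk (gk i).
Qed.

(** Here the intermediate space is arbitrary, as is needed for charts of products. Since [a] has
    constant differential [l], differentiating [g \o a] along [v] gives a derivative of [g] along
    [l v], composed with [a]. *)
Lemma Ck_comp_affine V V' W k (U : set V') (a l : V -> V') (g : V' -> W) :
  open (a @^-1` U) -> (forall x, is_diff x a l) ->
  Ck k U g -> Ck k (a @^-1` U) (g \o a).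
Proof.
move=> oU da.
have dax x : differentiable a x := @ex_diff _ _ _ _ _ _ _ (da x).
elim: k g => [|k IH] g.
  move=> gc x Ux; apply: continuous_comp; last exact: gc.
  exact: differentiable_continuous.
move=> [dg dgk]; split=> [x Ux|v].
  exact: differentiable_comp (dax x) (dg _ Ux).
apply: Ck_ext (IH _ (dgk (l v))) => // x Ux.
rewrite (diff_comp (dax x) (dg _ Ux)) /=.
by have -> := @diff_val _ _ _ _ _ _ _ (da x).
Qed.

Lemma smooth_near_comp V n m (f : V -> 'rV[R]_n) (g : 'rV[R]_n -> 'rV[R]_m) x :
  smooth_near f x -> smooth_near g (f x) -> smooth_near (g \o f) x.
Proof.
move=> [U [oU Ux fs]] [U' [oU' U'fx gs]].
have oUU : open (U `&` f @^-1` U').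
  rewrite openE => y [Uy U'fy]; apply: filterI; first exact: open_nbhs_nbhs.
  by apply: (fs 0%N y Uy); exact: open_nbhs_nbhs.
exists (U `&` f @^-1` U'); split=> // k.
apply: (@Ck_comp _ _ _ k _ U') (gs k) => //; first by move=> y [].
by apply: Ck_sub (fs k) => y [].
Qed.

Lemma smooth_near_comp_affine V V' W (a l : V -> V') (g : V' -> W) x :
  (forall x, is_diff x a l) -> smooth_near g (a x) -> smooth_near (g \o a) x.
Proof.
move=> da [U [oU Uax gs]].
have oaU : open (a @^-1` U).
  apply: open_comp oU => y _; apply: differentiable_continuous.
  exact: (@ex_diff _ _ _ _ _ _ _ (da y)).
by exists (a @^-1` U); split=> // k; exact: Ck_comp_affine.
Qed.

Lemma smooth_near_ext V W (f g : V -> W) x :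
  (\near x, f x = g x) -> smooth_near f x -> smooth_near g x.
Proof.
move=> fg; have : nbhs x (fun y => f y = g y) by [].
rewrite nbhsE => -[U' [oU' U'x] fgU'] [U [oU Ux fs]].
exists (U `&` U'); split=> //; first exact: openI.
move=> k; apply: (@Ck_ext _ _ k _ f); first exact: openI.
  by move=> y [_ /fgU'].
by apply: Ck_sub (fs k) => y [].
Qed.

Lemma smooth_near_diff V W (f : V -> W) x : smooth_near f x -> differentiable f x.
Proof. by move=> [U [_ Ux fs]]; have [df _] := fs 1%N; exact: df. Qed.

End CkClosure.

(** * Differentials of maps that agree on a level set *)

Section LevelSetDifferential.
Context (R : realType) (n m : nat).
Variables (U : set 'rV[R]_n) (h : 'rV[R]_n -> 'rV[R]_m) (x v : 'rV[R]_n).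
Hypotheses (oU : open U) (hC1 : Ck 1 U h) (Ux : U x).
Hypotheses (hsurj : forall z, exists u, 'd h x u = z) (dhv : 'd h x v = 0).

(** Move from [x] by [k = t v + w] inside the level set, with [w] of size at most [e t]. There [a]
    vanishes, so [D k] is at most [e |k|], and [t |D v|] is bounded by an arbitrarily small multiple
    of [t]. *)
Lemma diff_eq0_on_level_set (W : normedModType R) (a : 'rV[R]_n -> W) :
  differentiable a x -> (\forall y \near x, h y = h x -> a y = 0) ->
  'd a x v = 0.
Proof.
move=> da a0; have ax0 := nbhs_singleton a0 erefl.
have [ac aE] := (diff_approxP a ('d a x) x).1 (conj da erefl).
move: ('d a x) ac aE => D Dc aE.
have [C C0 DC] := linear_lipschitz Dc.
apply/eqP; rewrite -normr_eq0; apply/negP => /negP Dv0.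
have {}Dv0 : 0 < `|D v| by rewrite lt_def Dv0 normr_ge0.
have K0 : 0 < `|v| + 1 + C by rewrite addr_gt0 // ltr_wpDl.
(* The total error will be [t * e * (|v| + 1 + C)], so this choice keeps it below half of
   [t * |D v|]; the cap 1 absorbs a term quadratic in [e]. *)
pose e := Num.min 1 (`|D v| / (2 * (`|v| + 1 + C))).
have e0 : 0 < e by rewrite lt_min ltr01 divr_gt0 // mulr_gt0.
have e1 : e <= 1 by rewrite ge_min lexx.
have eK : e * (`|v| + 1 + C) <= `|D v| / 2.
  rewrite -ler_pdivlMr // -mulrA -invfM; rewrite /e ge_min.
  by rewrite lexx orbT.
have /nbhs_normP[r r0 rP] : \forall k \near (0 : 'rV[R]_n),
    `|a (k + x) - a x - D k| <= e * `|k| /\ (h (k + x) = h x -> a (k + x) = 0).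
  near=> k; split; near: k; first exact: aE.
  by move: a0; rewrite (near_shift 0 x) subr0.
have [d d0 dP] := level_set_tangent oU hC1 Ux hsurj dhv e0.
have ve0 : 0 < `|v| + e by rewrite ltr_wpDl.
(* The first bound gives the point on the level set, the second puts [k] within [r] of 0; the halves
   make both inequalities strict. *)
pose t := Num.min (d / 2) (r / (2 * (`|v| + e))).
have t0 : 0 < t by rewrite lt_min !divr_gt0 // mulr_gt0.
have td : t < d.
  by rewrite gt_min ltr_pdivrMr // mulrDr mulr1 ltrDl d0.
have tr : t * (`|v| + e) < r.
  rewrite -ltr_pdivlMr // gt_min; apply/orP; right.
  by rewrite invfM mulrA ltr_pM2r ?invr_gt0 // ltr_pdivrMr // mulrDr mulr1 ltrDl.
have [|w we hw] := dP t; first by rewrite t0.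
pose k := t *: v + w.
have kn : `|k| <= t * (`|v| + e).
  apply: le_trans (ler_normD _ _) _.
  by rewrite normrZ (gtr0_norm t0) mulrDr lerD2l mulrC.
have [|ak hk] := rP k.
  by rewrite /ball_ /= sub0r normrN; exact: le_lt_trans kn tr.
have ak0 : a (k + x) = 0 by apply: hk; rewrite addrC addrA.
move: ak; rewrite ak0 ax0 subrr sub0r normrN => Dk.
have Dvt : t * `|D v| <= `|D k| + `|D w|.
  rewrite -{1}(gtr0_norm t0) -normrZ -linearZ -[t *: v](addrK w) -/k linearB.
  exact: ler_normB.
have : t * `|D v| <= t * (e * (`|v| + 1 + C)).
  apply: le_trans Dvt _.
  have := DC w; have : C * `|w| <= C * (e * t) by rewrite ler_pM2l.
  have : e * `|k| <= e * (t * (`|v| + e)) by rewrite ler_pM2l.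
  have : e * (t * (`|v| + e)) <= e * (t * (`|v| + 1)).
    by rewrite ler_pM2l // ler_pM2l // lerD2l.
  rewrite -(_ : e * (t * (`|v| + 1)) + C * (e * t) = t * (e * (`|v| + 1 + C)));
    last by ring.
  lra.
rewrite ler_pM2l // => /le_trans /(_ eK).
lra.
Unshelve. all: by end_near. Qed.

Lemma diff_eq_on_level_set (W : normedModType R) (a b : 'rV[R]_n -> W) :
  differentiable a x -> differentiable b x ->
  (\forall y \near x, h y = h x -> a y = b y) -> 'd a x v = 'd b x v.
Proof.
move=> da db ab; apply/subr0_eq.
have := @diff_eq0_on_level_set W (a - b) (differentiableB da db).
rewrite [X in X v](diffB da db); apply.
by apply: filterS ab => y ab /ab; rewrite !fctE => ->; rewrite subrr.
Qed.

End LevelSetDifferential.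

(** * Calculus on manifolds *)

Section ManifoldCalculus.
Context (R : realType).
Implicit Types M N P : manifold R.

Lemma mcoordKx M (x : M) : mparam x (mcoord x x) = x.
Proof. by rewrite mcoordK //; exact: mdom_mem. Qed.

Lemma mparam_near M (x : M) (A : set M) : nbhs x A ->
  \forall u \near mcoord x x, A (mparam x u).
Proof.
move=> xA; apply: (@mparam_continuous _ M x (mcoord x x)).
  by exists x => //; exact: mdom_mem.
by rewrite mcoordKx.
Qed.

Lemma continuous_comp_mparam M (T : topologicalType) (f : M -> T) (x : M) :
  {for x, continuous f} -> forall A, nbhs (f x) A ->
  \forall u \near mcoord x x, A (f (mparam x u)).
Proof. by move=> fc A fA; apply: (mparam_near (A := f @^-1` A)); exact: fc. Qed.

Lemma mparam_mcoord_near M N (f : M -> N) (x : M) : {for x, continuous f} ->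
  \forall u \near mcoord x x,
    mparam (f x) (mcoord (f x) (f (mparam x u))) = f (mparam x u).
Proof.
move=> fc; have := continuous_comp_mparam fc
  (open_nbhs_nbhs (conj (mdom_open (f x)) (mdom_mem (f x)))).
by apply: filterS => u; exact: mcoordK.
Qed.

Lemma local_rep_mcoord M N (f : M -> N) (x : M) :
  local_rep f x (mcoord x x) = mcoord (f x) (f x).
Proof. by rewrite /local_rep /= mcoordKx. Qed.

(** Only a local identity: continuity of [f] keeps nearby values in the chart domain at [f x], where
    the inner chart and its inverse cancel. *)
Lemma local_rep_comp M N P (f : M -> N) (psi : N -> P) (x : M) :
  {for x, continuous f} ->
  \forall u \near mcoord x x,
    (local_rep psi (f x) \o local_rep f x) u = local_rep (psi \o f) x u.
Proof.
move=> /mparam_mcoord_near; apply: filterS => u uE.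
by rewrite /local_rep /= uE.
Qed.

Lemma smooth_at_comp M N P (f : M -> N) (psi : N -> P) (x : M) :
  smooth_at f x -> smooth_at psi (f x) -> smooth_at (psi \o f) x.
Proof.
move=> [fc fs] [pc ps]; split; first exact: continuous_comp.
apply: smooth_near_ext (local_rep_comp _ fc) _.
by apply: smooth_near_comp => //; rewrite local_rep_mcoord.
Qed.

Lemma differential_comp M N P (f : M -> N) (psi : N -> P) (x : M) v :
  smooth_at f x -> smooth_at psi (f x) ->
  differential (psi \o f) x v = differential psi (f x) (differential f x v).
Proof.
move=> [fc /smooth_near_diff fs] [pc /smooth_near_diff ps].
have {}ps : differentiable (local_rep psi (f x)) (local_rep f x (mcoord x x)).
  by rewrite local_rep_mcoord.
have [_ dE] := near_eq_diff (local_rep_comp psi fc) (differentiable_comp fs ps).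
by rewrite /differential dE (diff_comp fs ps) /= mcoordKx.
Qed.

Lemma differential_cst M N (y : N) (x : M) v : differential (fun=> y) x v = 0.
Proof.
have E : local_rep (fun=> y) x = cst (mcoord y y) :> (_ -> _) by [].
by rewrite /differential; rewrite E (diff_cst (mcoord y y) (mcoord x x)).
Qed.

Lemma smooth_at_cst M N (y : N) (x : M) : smooth_at (fun=> y : N) x.
Proof.
split; first exact: cst_continuous.
by exists setT; split=> //; [exact: openT|move=> k; exact: Ck_cst].
Qed.

(* Every vector in the kernel of the differential of p is tangent to the fibre
   of p, so this is the well-definedness of differentials along fibres. *)
Lemma differential_eq_on_fibre M N P (p : M -> N) (F1 F2 : M -> P) (x : M) v :
  smooth_at p x -> (forall w, exists u, differential p x u = w) ->
  differential p x v = 0 -> smooth_at F1 x -> smooth_at F2 x ->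
  (\forall y \near x, p y = p x -> F1 y = F2 y) ->
  differential F1 x v = differential F2 x v.
Proof.
move=> [pc [U [oU Ux ps]]] psurj pv [_ /smooth_near_diff d1] [_ /smooth_near_diff d2] F12.
have F12x := nbhs_singleton F12 erefl.
have F12u : \forall u \near mcoord x x,
    local_rep p x u = local_rep p x (mcoord x x) ->
    local_rep F1 x u = local_rep F2 x u.
  near=> u; rewrite local_rep_mcoord /local_rep /= => pu.
  rewrite F12x; congr (mcoord _ _).
  have uF : p (mparam x u) = p x -> F1 (mparam x u) = F2 (mparam x u).
    by near: u; exact: (mparam_near F12).
  (* Equality in the chart becomes equality of points because [p (mparam x u)] lies in the chart
     domain at [p x] for [u] near the centre. *)
  apply: uF; rewrite -[RHS]mcoordKx -pu; apply/esym.
  by near: u; exact: mparam_mcoord_near.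
exact: (diff_eq_on_level_set oU (ps 1%N) Ux psurj pv d1 d2 F12u).
Unshelve. all: by end_near. Qed.

Lemma differential_withinP M N (S : set M) (f : M -> N) (x : M) :
  (exists F : M -> N, local_extension S f x F) ->
  exists2 F : M -> N, local_extension S f x F &
    forall v, differential_within S f x v = differential F x v.
Proof.
move=> h; rewrite /differential_within; case: pselect => [h'|//].
by exists (projT1 (cid h')) => //; exact: (projT2 (cid h')).
Qed.

(** A chain rule along the fibre of [p]. The chosen extension [F] follows [f] only on that fibre,
    but there [psi \o F] agrees with [chi], and [v] is tangent to it. With [p] the source map this
    computes the images of invariant vectors. *)
Lemma differential_within_fibre M N P (q : P) (p : M -> P) (f : M -> N)
    (N' : manifold R) (psi : N -> N') (chi : M -> N') (x : M) v :
  smooth_at p x -> (forall w, exists u, differential p x u = w) ->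
  differential p x v = 0 -> p x = q ->
  (exists F : M -> N, local_extension [set k | p k = q] f x F) ->
  smooth_at psi (f x) -> smooth_at chi x ->
  (forall k, p k = q -> psi (f k) = chi k) ->
  differential psi (f x) (differential_within [set k | p k = q] f x v) =
  differential chi x v.
Proof.
move=> ps psurj pv <- /differential_withinP[F [Fs Ff] ->] psis chis pf.
have Fx : F x = f x by exact: (nbhs_singleton Ff).
rewrite -Fx in psis *.
rewrite -(differential_comp v Fs psis).
apply: (differential_eq_on_fibre ps psurj pv) => //; first exact: smooth_at_comp.
by apply: filterS Ff => y yF py /=; rewrite yF // pf.
Qed.

End ManifoldCalculus.

(** * Invariant vector fields *)

Section Translations.
Context (R : realType) (G : lieGroupoid R).
Implicit Types (g h r : G) (q : base G).

Lemma tmapE (M N : manifold R) (f : M -> N) (x : M) v :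
  tmap f x v = differential f x v.
Proof. by rewrite lfunE. Qed.
Arguments tmapE {M N} f x v.

Lemma submersion_differential (M N : manifold R) (p : M -> N) (x : M) :
  submersion p -> forall w, exists u, differential p x u = w.
Proof. by move=> [_ ps] w; have [u <-] := ps x w; exists u; rewrite tmapE. Qed.

Lemma inv_unit q : Defs.inv (unit q) = unit q :> G.
Proof.
have := mul_unitr (Defs.inv (unit q) : G).
by rewrite tgt_inv src_unit mul_invl tgt_unit.
Qed.

(** Freeze the first argument in a local extension [M] of multiplication around [(g, unit q)];
    points of the src-fibre over [q] are exactly those composable with [g]. *)
Lemma local_extension_mul_left g q : tgt g = q ->
  exists F : G -> G, local_extension [set k : G | src k = q] (Defs.mul g) (unit q) F.
Proof.
move=> gq; have [|M [[Mc Ms] MG]] := @mul_smooth R G (g, unit q).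
  by rewrite /= src_unit.
have pc : (fun k : G => (g, k)) @ unit q --> (g, unit q : G).
  by apply: cvg_pair; [exact: cvg_cst|exact: cvg_id].
exists (fun k => M (g, k)); split; last first.
  have MGg : \forall k \near (unit q : G),
    tgt g = src k -> M (g, k) = Defs.mul g k := pc _ MG.
  by apply: filterS MGg => k Mk Sk; rewrite Mk // Sk.
split; first exact: cvg_comp pc Mc.
have -> : local_rep (fun k : G => M (g, k)) (unit q) =
    @local_rep R (prod_charted G G) G M (g, unit q) \o
      (fun u : model G => (mcoord g g, u)).
  by apply/funext => u; rewrite /local_rep /= mcoordKx.
exact: smooth_near_comp_affine Ms.
Qed.

Lemma local_extension_mul_inv g q : src g = q ->
  exists F : G -> G,
    local_extension [set k : G | src k = q] (fun k => Defs.mul (Defs.inv k) g) (unit q) F.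
Proof.
move=> gq; have [|M [[Mc Ms] MG]] := @mul_smooth R G (Defs.inv (unit q), g).
  by rewrite /= tgt_inv src_unit.
have [ic invs] := @inv_smooth R G (unit q).
have pc : (fun k : G => (Defs.inv k, g)) @ unit q --> (Defs.inv (unit q) : G, g).
  by apply: cvg_pair; [exact: ic|exact: cvg_cst].
exists (fun k => M (Defs.inv k, g)); split; last first.
  have MGg : \forall k \near (unit q : G), tgt (Defs.inv k) = src g ->
    M (Defs.inv k, g) = Defs.mul (Defs.inv k) g := pc _ MG.
  by apply: filterS MGg => k Mk Sk; rewrite Mk // tgt_inv Sk.
split; first exact: cvg_comp pc Mc.
pose j (w : model G) : model (prod_charted G G) := (w, mcoord g g).
(* Inversion must land in the chart domain at [inv (unit q)], hence equality only near the centre;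
   [j] is the affine inclusion at the fixed second argument. *)
have E : \forall u \near mcoord (unit q) (unit q),
    (@local_rep R (prod_charted G G) G M (Defs.inv (unit q), g) \o j \o
      local_rep (@Defs.inv R G) (unit q)) u =
    local_rep (fun k : G => M (Defs.inv k, g)) (unit q) u.
  have := mparam_mcoord_near ic; apply: filterS => u uE.
  by rewrite /local_rep /j /= uE mcoordKx.
apply: smooth_near_ext E _.
apply: smooth_near_comp invs _.
apply: (@smooth_near_comp_affine _ _ _ _ j (fun w => (w, 0))).
by rewrite /j local_rep_mcoord.
Qed.

Lemma smooth_at_src g : smooth_at (@src R G) g.
Proof. exact: (src_submersion G).1. Qed.

Lemma smooth_at_tgt g : smooth_at (@tgt R G) g.
Proof. exact: (tgt_submersion G).1. Qed.

Variable X : algebroid_section G.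

Lemma asec_src q : differential (@src R G) (unit q) (asec X q) = 0.
Proof.
by have := asec_mem X q; rewrite memv_ker tmapE => /eqP.
Qed.

Lemma differential_left_invariant g (psi : G -> base G) (chi : G -> base G) :
  smooth_at psi g -> smooth_at chi (unit (tgt g)) ->
  (forall k, src k = tgt g -> psi (Defs.mul g k) = chi k) ->
  differential psi g (left_invariant X g) =
  differential chi (unit (tgt g)) (asec X (tgt g)).
Proof.
move=> psis chis pE.
have := @differential_within_fibre R G G (base G) (tgt g) (@src R G) (Defs.mul g)
  (base G) psi chi (unit (tgt g)) (asec X (tgt g)) (smooth_at_src _)
  (submersion_differential _ (src_submersion G)) (asec_src _) (src_unit _)
  (local_extension_mul_left erefl).
by rewrite mul_unitr; apply.
Qed.

Lemma differential_right_invariant g (psi : G -> base G) (chi : G -> base G) :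
  smooth_at psi g -> smooth_at chi (unit (src g)) ->
  (forall k, src k = src g -> psi (Defs.mul (Defs.inv k) g) = chi k) ->
  differential psi g (right_invariant X g) =
  - differential chi (unit (src g)) (asec X (src g)).
Proof.
move=> psis chis pE.
apply: etrans (linearN (differential psi g) _) _; congr (- _).
have := @differential_within_fibre R G G (base G) (src g) (@src R G)
  (fun k => Defs.mul (Defs.inv k) g)
  (base G) psi chi (unit (src g)) (asec X (src g)) (smooth_at_src _)
  (submersion_differential _ (src_submersion G)) (asec_src _) (src_unit _)
  (local_extension_mul_inv erefl).
by rewrite inv_unit mul_unitl; apply.
Qed.

Lemma tmap_src_left_invariant g : tmap (@src R G) g (left_invariant X g) = 0.
Proof.
apply: etrans (tmapE _ _ _) _.
apply: etrans (@differential_left_invariant g _ (fun=> src g) _ _ _) _.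
- exact: smooth_at_src.
- exact: smooth_at_cst.
- by move=> k gk; rewrite src_mul.
- exact: differential_cst.
Qed.

Lemma tmap_tgt_left_invariant g : tmap (@tgt R G) g (left_invariant X g) =
  tmap (@tgt R G) (unit (tgt g)) (asec X (tgt g)).
Proof.
have E : differential (@tgt R G) g (left_invariant X g) =
    differential (@tgt R G) (unit (tgt g)) (asec X (tgt g)).
  apply: differential_left_invariant; [exact: smooth_at_tgt|exact: smooth_at_tgt|].
  by move=> k gk; rewrite tgt_mul.
(* The sides are tangent vectors at [tgt g] and at [tgt (unit (tgt g))]; their types agree by
   conversion, so the equations are chained by transitivity. *)
have A := tmapE (@tgt R G) g (left_invariant X g).
have B := tmapE (@tgt R G) (unit (tgt g)) (asec X (tgt g)).
exact: etrans (etrans A E) (esym B).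
Qed.

Lemma tmap_src_right_invariant g : tmap (@src R G) g (right_invariant X g) =
  - tmap (@tgt R G) (unit (src g)) (asec X (src g)).
Proof.
have E : differential (@src R G) g (right_invariant X g) =
    - differential (@tgt R G) (unit (src g)) (asec X (src g)).
  apply: differential_right_invariant; [exact: smooth_at_src|exact: smooth_at_tgt|].
  by move=> k gk; rewrite src_mul ?src_inv ?tgt_inv.
have A := tmapE (@src R G) g (right_invariant X g).
have B := tmapE (@tgt R G) (unit (src g)) (asec X (src g)).
exact: etrans (etrans A E) (esym (congr1 -%R B)).
Qed.

Lemma tmap_tgt_right_invariant g : tmap (@tgt R G) g (right_invariant X g) = 0.
Proof.
apply: etrans (tmapE _ _ _) _.
apply: etrans (@differential_right_invariant g _ (fun=> tgt g) _ _ _) _.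
- exact: smooth_at_tgt.
- exact: smooth_at_cst.
- by move=> k gk; rewrite tgt_mul ?tgt_inv.
- by apply/eqP; rewrite oppr_eq0; apply/eqP; exact: differential_cst.
Qed.

End Translations.

(** * Dependent pairs and linear functions *)

Lemma existT_inj (T : Type) (P : T -> Type) (x : T) (a b : P x) :
  existT P x a = existT P x b -> a = b.
Proof. by apply: inj_pair2_eq_dec => y z; exact: pselect. Qed.

Section LinearFunctions.
Context (R : realType).
Implicit Types T A B C : vectType R.

Lemma linfunE_linear T A (f : T -> A) : linear f -> linfun f =1 f.
Proof.
move=> fl; pose fM := GRing.isLinear.Build _ _ _ _ _ fl.
pose L : {linear _ -> _} := HB.pack f fM.
exact: (lfunE L).
Qed.

Lemma mem_lker_sub T A B C (a : {linear T -> A}) (b : {linear T -> B})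
    (f : 'Hom(A, C)) (g : 'Hom(B, C)) u :
  (u \in lker (linfun (fun u => f (a u) - g (b u)))) = (f (a u) == g (b u)).
Proof.
rewrite memv_ker linfunE_linear ?subr_eq0 // => k v w.
by rewrite (linearP a) (linearP b) (linearP f) (linearP g) scalerBr opprD addrACA.
Qed.

Lemma mem_lker_comp T A C (a : {linear T -> A}) (f : 'Hom(A, C)) u :
  (u \in lker (linfun (fun u => f (a u)))) = (f (a u) == 0).
Proof. by rewrite memv_ker linfunE_linear // => k v w; rewrite (linearP a) (linearP f). Qed.

End LinearFunctions.

(** * The prolongation *)

Section Prolongation.
Context (R : realType) (G : lieGroupoid R).
Implicit Types (g h r : G) (p : G * G * G).

Lemma mem_Tprolongation p (u : tangent3 p) :
  tmap (@src R G) p.1.1 u.1.1 = tmap (@src R G) p.1.2 u.1.2 ->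
  tmap (@tgt R G) p.1.2 u.1.2 = tmap (@src R G) p.2 u.2 ->
  u \in Tprolongation p.
Proof.
move=> E1 E2; rewrite memv_cap; apply/andP; split.
  rewrite (@mem_lker_sub R _ _ _ _ (fst \o fst) (snd \o fst)
    (tmap (@src R G) p.1.1) (tmap (@src R G) p.1.2)).
  exact/eqP.
rewrite (@mem_lker_sub R _ _ _ _ (snd \o fst) snd
  (tmap (@tgt R G) p.1.2) (tmap (@src R G) p.2)).
exact/eqP.
Qed.

Lemma mem_TG2 (gh : G * G) (u : (tangent gh.1 * tangent gh.2)%type) :
  (u \in TG2 gh) = (tmap (@tgt R G) gh.1 u.1 == tmap (@src R G) gh.2 u.2).
Proof.
exact: (@mem_lker_sub R _ _ _ _ fst snd
  (tmap (@tgt R G) gh.1) (tmap (@src R G) gh.2)).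
Qed.

Lemma mem_Aprolongation (Z : prolongation_section G) g :
  (asec (psecX Z) (src g), psecY Z g) \in Aprolongation g.
Proof.
rewrite memv_cap; apply/andP; split.
  rewrite (@mem_lker_comp R _ _ _ fst (tmap (@src R G) (unit (src g)))) /=.
  by have := asec_mem (psecX Z) (src g); rewrite memv_ker.
rewrite (@mem_lker_sub R _ _ _ _ snd fst
  (tmap (@src R G) g) (tmap (@tgt R G) (unit (src g)))).
by apply/eqP; exact: psec_anchor.
Qed.

Lemma psec_valE (Z : prolongation_section G) g :
  vsval (psec_val Z g) = (asec (psecX Z) (src g), psecY Z g).
Proof. exact: vsprojK (mem_Aprolongation Z g). Qed.

(** [vsproj] is faithful only on the subspace, so tangency is the point: the source condition reads
    0 = 0, and the target condition is the anchor condition on [Z] at the third component. *)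
Lemma prolongation_leftE (Z : prolongation_section G) p : prolongation p ->
  vsval (prolongation_left Z p) =
  ((0, left_invariant (psecX Z) p.1.2), psecY Z p.2).
Proof.
move=> [p1 p2]; apply: vsprojK; apply: mem_Tprolongation => /=.
  apply: etrans (linear0 _) _; apply/esym; exact: tmap_src_left_invariant.
have A := tmap_tgt_left_invariant (psecX Z) p.1.2.
have B := psec_anchor Z p.2.
apply: etrans A _; apply: etrans _ (esym B).
by rewrite p2.
Qed.

Lemma prolongation_rightE (Z : prolongation_section G) p : prolongation p ->
  vsval (prolongation_right Z p) =
  ((- psecY Z p.1.1, right_invariant (psecX Z) p.1.2), 0).
Proof.
move=> [p1 p2]; apply: vsprojK; apply: mem_Tprolongation => /=.
  have A := tmap_src_right_invariant (psecX Z) p.1.2.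
  have B := psec_anchor Z p.1.1.
  apply: etrans (linearN _ _) _; apply: etrans _ (esym A); congr (- _).
  apply: etrans B _.
  by rewrite p1.
apply: etrans (tmap_tgt_right_invariant _ _) _; apply/esym; exact: linear0.
Qed.

End Prolongation.

(** * The cotangent groupoid *)

Section CotangentGroupoid.
Context (R : realType) (G : lieGroupoid R).
Implicit Types (g h r : G) (p : G * G * G).

(** Existence ensures that [xget] returns a functional with the defining property instead of the
    default 0. The left-invariant vector depends linearly, through [D], on the value of the section
    at [src r], so the formula extends to the whole fibre. *)
Lemma cotangent_tgt_ex g h r (m : 'Hom(subvs_of (Tprolongation ((g, h), r)), R^o)) :
  tgt h = src r -> exists nu : 'Hom(subvs_of (Aprolongation r), R^o),
    forall Z, nu (psec_val Z r) = m (prolongation_left Z ((g, h), r)).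
Proof.
move=> hr; pose D : {linear model G -> model G} :=
  @differential_within R G G [set k | src k = src r] (Defs.mul h) (unit (src r)).
have DE X : left_invariant X h = D (asec X (src r)) by rewrite /D -hr.
pose f (z : subvs_of (Aprolongation r)) : R^o :=
  m (vsproj (Tprolongation ((g, h), r)) ((0, D (vsval z).1), (vsval z).2)).
have fl : linear f.
  move=> k z w; rewrite /f -linearP -linearP; congr (m (vsproj _ _)).
  have E : (vsval (k *: z + w)) = k *: vsval z + vsval w by exact: linearP.
  rewrite E; congr (_, _); congr (_, _).
    by rewrite /= scaler0 addr0.
  exact: (linearP D).
exists (linfun f) => Z; apply: etrans (linfunE_linear fl _) _.
by rewrite /f psec_valE /prolongation_left DE.
Qed.

Lemma cotangent_src_ex g h r (m : 'Hom(subvs_of (Tprolongation ((g, h), r)), R^o)) :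
  src h = src g -> exists nu : 'Hom(subvs_of (Aprolongation g), R^o),
    forall Z, nu (psec_val Z g) = m (prolongation_right Z ((g, h), r)).
Proof.
move=> hg; pose D : {linear model G -> model G} :=
  @differential_within R G G [set k | src k = src g]
    (fun k => Defs.mul (Defs.inv k) h) (unit (src g)).
have DE X : right_invariant X h = - D (asec X (src g)) by rewrite /D -hg.
pose f (z : subvs_of (Aprolongation g)) : R^o :=
  m (vsproj (Tprolongation ((g, h), r))
    ((- (vsval z).2, - D (vsval z).1), 0)).
have fl : linear f.
  move=> k z w; rewrite /f -linearP -linearP; congr (m (vsproj _ _)).
  have E : (vsval (k *: z + w)) = k *: vsval z + vsval w by exact: linearP.
  rewrite E; congr (_, _); last by rewrite /= scaler0 addr0.
  congr (_, _); first by rewrite /= scalerN opprD.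
  apply: etrans (congr1 -%R (linearP D k _ _)) _.
  by rewrite /= scalerN opprD.
exists (linfun f) => Z; apply: etrans (linfunE_linear fl _) _.
by rewrite /f psec_valE /prolongation_right DE.
Qed.

Lemma cotangent_src_tgtP g h r h' r'
    (m : 'Hom(subvs_of (Tprolongation ((g, h), r)), R^o))
    (m' : 'Hom(subvs_of (Tprolongation ((r, h'), r')), R^o)) :
  tgt h = src r -> src h' = src r ->
  cotangent_src (existT _ ((r, h'), r') m') =
    cotangent_tgt (existT _ ((g, h), r) m) <->
  forall Z, m' (prolongation_right Z ((r, h'), r')) =
    m (prolongation_left Z ((g, h), r)).
Proof.
move=> /cotangent_tgt_ex-/(_ g m)[nu nuE] /cotangent_src_ex-/(_ r' m')[nu' nuE'].
split=> [E Z|mE].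
  have nn := existT_inj E.
  have l := xgetPex 0 (ex_intro [set nu : 'Hom(subvs_of (Aprolongation r), R^o) |
    forall Z, nu (psec_val Z r) = m (prolongation_left Z ((g, h), r))] nu nuE) Z.
  have l' := xgetPex 0 (ex_intro [set nu : 'Hom(subvs_of (Aprolongation r), R^o) |
    forall Z, nu (psec_val Z r) = m' (prolongation_right Z ((r, h'), r'))] nu' nuE') Z.
  have e := congr1 (fun f : 'Hom(subvs_of (Aprolongation r), R^o) =>
    f (psec_val Z r)) nn.
  exact: etrans (esym l') (etrans e l).
(* Equal pairings make the two defining sets equal, so [xget] selects the same functional from
   both. *)
have E : [set nu : 'Hom(subvs_of (Aprolongation r), R^o) |
      forall Z, nu (psec_val Z r) = m' (prolongation_right Z ((r, h'), r'))] =
    [set nu | forall Z, nu (psec_val Z r) = m (prolongation_left Z ((g, h), r))].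
  apply/seteqP; split => f fE Z; first exact: etrans (fE Z) (mE Z).
  exact: etrans (fE Z) (esym (mE Z)).
pose F (S : set 'Hom(subvs_of (Aprolongation r), R^o)) : ASprolongation G :=
  existT _ r (xget 0 S).
exact: (congr1 F E).
Qed.

Lemma restrict3E g h r (a : cotangent g) (b : cotangent h) (c : cotangent r) u :
  projT2 (restrict3 a b c) u = a (vsval u).1.1 + b (vsval u).1.2 + c (vsval u).2.
Proof.
apply: linfunE_linear u => k u w.
have E : (vsval (k *: u + w)) = k *: vsval u + vsval w by exact: linearP.
have lin (T : vectType R) (f : 'Hom(T, R^o)) v v' :
  f (k *: v + v') = k *: f v + f v' := linearP f k v v'.
rewrite E /= (lin _ a) (lin _ b) (lin _ c) !scalerDr.
by rewrite [X in X + _ = _]addrACA; exact: addrACA.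
Qed.

(** The tangent map of [iG2] doubles the first component, which is why [a] and [b] enter only
    through their sum; linearity of [D] splits [dL] into its two partial differentials. *)
Lemma SigmaLP (L : G * G -> R) g r (a b : cotangent g) (c : cotangent r) :
  G2 (g, r) ->
  SigmaL L (restrict3 a b c) <->
  forall u, u \in TG2 (g, r) ->
    (a + b) u.1 + c u.2 = D1L L (g, r) u.1 + D2L L (g, r) u.2.
Proof.
move=> gr.
pose D := @differential_within R (prod_charted G G) (real_charted R) (@G2 R G) L (g, r).
have D1E w : D1L L (g, r) w = D (w, 0).
  apply: linfunE_linear w => k w w'; rewrite -(linearP D); congr (D (_, _)).
  by rewrite /= scaler0 addr0.
have D2E w : D2L L (g, r) w = D (0, w).
  apply: linfunE_linear w => k w w'; rewrite -(linearP D); congr (D (_, _)).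
  by rewrite /= scaler0 addr0.
have DE w : D1L L (g, r) w.1 + D2L L (g, r) w.2 = D w.
  rewrite D1E D2E -(linearD D); congr (D _).
  by case: w => w1 w2; congr (_, _); rewrite /= ?addr0 ?add0r.
have dLE w : dL L (g, r) w = D (vsval w).
  apply: linfunE_linear w => k w w'.
  have E : vsval (k *: w + w') = k *: vsval w + vsval w' by exact: linearP.
  exact: etrans (congr1 D E) (linearP D k (vsval w) (vsval w')).
have TE (u : subvs_of (TG2 (g, r))) :
    projT2 (restrict3 a b c) (TiG2 (g, r) u) =
    (a + b) (vsval u).1 + c (vsval u).2.
  have -> : TiG2 (g, r) u = vsproj (Tprolongation (iG2 (g, r)))
      (((vsval u).1, (vsval u).1), (vsval u).2).
    apply: linfunE_linear u => k u w; rewrite -linearP; congr (vsproj _ _).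
  rewrite restrict3E vsprojK /= ?lfunE //.
  apply: mem_Tprolongation => //=.
  by have := subvsP u; rewrite mem_TG2 => /eqP.
split=> [[gh [m [_ E mL]]] u uT|abc].
  move: gh m E mL => [g' r'] m E mL.
  (* Membership in [SigmaL] only asserts some base point; equality of the pairs forces it to be
     [(g, r)]. *)
  case: (EqdepFacts.eq_sigT_fst E) => ? _ ?; subst g' r'.
  have mE := existT_inj E.
  rewrite DE -(vsprojK uT) -dLE -TE -mL comp_lfunE.
  by congr (fun_of_lfun _ _).
exists (g, r), (projT2 (restrict3 a b c)); split=> //.
by apply/lfunP => u; rewrite comp_lfunE dLE -DE TE abc // subvsP.
Qed.

End CotangentGroupoid.

(** * The dynamics as a system of equations *)

Theorem theorem4p5 (R : realType) (G : lieGroupoid R)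
    (L : G * G -> R) (L_smooth : lagrangian L)
    (N : nat) (g : nat -> G)
    (g_G2 : forall k : nat, (1 <= k <= N - 1)%N -> G2 (g k, g k.+1))
    (mu mut : forall k : nat, cotangent (g k))
    (mub : forall k : nat, cotangent (g k.+1)) :
  second_order_dynamics L N
    (fun k => restrict3 (mu k) (mut k) (mub k)) <->
  (forall k : nat, (1 <= k <= N - 2)%N -> forall Z : prolongation_section G,
     mut k (left_invariant (psecX Z) (g k)) + mub k (psecY Z (g k.+1)) =
     mut k.+1 (right_invariant (psecX Z) (g k.+1))
       - mu k.+1 (psecY Z (g k.+1))) /\
  (forall k : nat, (1 <= k <= N - 1)%N ->
     forall u, u \in TG2 (g k, g k.+1) ->
       (mu k + mut k) u.1 + mub k u.2 =
       D1L L (g k, g k.+1) u.1 + D2L L (g k, g k.+1) u.2).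
Proof.
(* The matching condition at index [k.+1] is the recursion at index [k], so the range from 2 to
   [N - 1] becomes the range from 1 to [N - 2]. *)
have dynP k : (1 <= k <= N - 2)%N ->
    cotangent_src (restrict3 (mu k.+1) (mut k.+1) (mub k.+1)) =
      cotangent_tgt (restrict3 (mu k) (mut k) (mub k)) <->
    forall Z : prolongation_section G,
      mut k (left_invariant (psecX Z) (g k)) + mub k (psecY Z (g k.+1)) =
      mut k.+1 (right_invariant (psecX Z) (g k.+1))
        - mu k.+1 (psecY Z (g k.+1)).
  move=> kN; have gk : G2 (g k, g k.+1) by apply: g_G2; lia.
  have gSk : G2 (g k.+1, g k.+2) by apply: g_G2; lia.
  apply: iff_trans (cotangent_src_tgtP _ _ gk erefl) _.
  have lE Z : projT2 (restrict3 (mu k) (mut k) (mub k))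
      (prolongation_left Z ((g k, g k), g k.+1)) =
      mut k (left_invariant (psecX Z) (g k)) + mub k (psecY Z (g k.+1)).
    by rewrite restrict3E prolongation_leftE //= linear0 add0r.
  have rE Z : projT2 (restrict3 (mu k.+1) (mut k.+1) (mub k.+1))
      (prolongation_right Z ((g k.+1, g k.+1), g k.+2)) =
      mut k.+1 (right_invariant (psecX Z) (g k.+1)) - mu k.+1 (psecY Z (g k.+1)).
    by rewrite restrict3E prolongation_rightE //= linear0 addr0 linearN addrC.
  split=> E Z; first exact: etrans (esym (lE Z)) (etrans (esym (E Z)) (rE Z)).
  exact: etrans (rE Z) (etrans (esym (E Z)) (esym (lE Z))).
split=> [[gS gD]|[gD gS]]; split=> k kN.
- by apply/dynP => //; apply: (gD k.+1); lia.
- by apply/SigmaLP; [exact: g_G2|exact: gS].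
- by apply/SigmaLP; [exact: g_G2|exact: gS].
- case: k kN => [|k] kN; first by exfalso; lia.
  have k1 : (1 <= k <= N - 2)%N by lia.
  exact: (dynP k k1).2 (gD k k1).
Qed.
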